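(* Let $X$ be a topological space, and let $\Gamma$ be one of $\Gamma^{BM}_r$ with $r\in\{o,p,f,k\}$, or $\Gamma^{OD}_{t,q}$ with $t\in\{o,p\}$ and $q\in\{l,k\}$. (1) If $X$ is nonmeager and $X$ is a $\Gamma$-space, then $X$ is $\Gamma$-nonmeager. (2) If $X$ is a Baire space and $X$ is a $\Gamma$-space, then $X$ is a $\Gamma$-Baire space.
   Context: Let $\mathcal T$ be the topology of $X$, $\mathcal T^*=\mathcal T\setminus\{\varnothing\}$, $\omega=\{0,1,2,\dots\}$. $X$ is Baire (nonmeager) if every countable intersection of dense open subsets of $X$ is dense (nonempty). $\mathfrak V(X)$: all sequences $(V_n)_{n\in\omega}$ in $\mathcal T^*$ with $V_{n+1}\subset V_n$. $\mathfrak V_{BM}(X)$: those $(V_n)\in\mathfrak V(X)$ with $\bigcap_nV_n\ne\varnothing$; $\mathfrak V_{BM}^*(X)=\mathfrak V(X)\setminus\mathfrak V_{BM}(X)$. $\mathfrak W(X)$: all sequences $(V_n,M_n)_{n\in\omega}$ with $V_n\in\mathcal T^*$, $\varnothing\neq M_n\subset X$, $V_{n+1}\subset V_n$, $M_{n+1}\subset V_n$. $\mathfrak W_e(X)$: those members of $\mathfrak W(X)$ with $\bigcap_nV_n=\varnothing$. For subsets $M_n\subset X$, $\overline{\mathrm{lt}}_{n}M_n$ is the set of $x\in X$ such that every neighborhood of $x$ meets $M_n$ for infinitely many $n$. For a nonprincipal ultrafilter $p$ on $\omega$ ($p\in\omega^*$), $x=\lim_p x_n$ means $\{n:x_n\in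 U\}\in p$ for every neighborhood $U$ of $x$. $\mathfrak W_l(X)$: those $(V_n,M_n)\in\mathfrak W(X)$ with $\overline{\mathrm{lt}}_nM_n\cap\bigcap_nV_n\neq\varnothing$. $\mathfrak W_k(X)$: those $(V_n,M_n)\in\mathfrak W(X)$ for which there are points $x_n\in M_n$ ($n\in\omega$) such that for every $p\in\omega^*$ there is $x\in\bigcap_nV_n$ with $x=\lim_px_n$. $\mathcal N_o(X)=\mathcal T^*$, $\mathcal N_p(X)=\{\{x\}:x\in X\}$. For $t\in\{o,p\}$, $\mathfrak V_t(X)$ is the set of $(V_n)\in\mathfrak V(X)$ such that $(V_n,M_n)_n\in\mathfrak W_l(X)$ whenever $M_n\in\mathcal N_t(X)$ and $M_n\subset V_n$ for all $n$. $\mathfrak V_f(X)$: those $(V_n)\in\mathfrak V_{BM}(X)$ such that for some $x\in\bigcap_nV_n$ the family $\{V_n\}$ is a base at $x$. $\mathfrak V_k(X)$: those $(V_n)\in\mathfrak V_{BM}(X)$ such that $M=\bigcap_nV_n$ is compact and $\{V_n\}$ is an outer base of $M$ (every open $W\supset M$ contains some $V_n$). Games (two players $\alpha$, $\beta$; strategies may depend on all previous moves). For $\mathcal V\subset\mathfrak V(X)$: in $BM(X,\mathcal V)$, $\alpha$ starts with $U_0=X$, in $MB(X,\mathcal V)$ with any $U_0\in\mathcal T^*$; $\beta$ answers $V_0\in\mathcal T^*$, $V_0\subset U_0$; on move $n\ge1$, $\alpha$ chooses $U_n\in\mathcal T^*$, $U_n\subset V_{n-1}$, then $\beta$ chooses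 $V_n\in\mathcal T^*$, $V_n\subset U_n$. $\alpha$ wins if $(V_n)\in\mathcal V$, otherwise $\beta$ wins. For a family $\mathcal N$ of nonempty sets such that each nonempty open set contains a member of $\mathcal N$, and $\mathcal W\subset\mathfrak W(X)$: $OD(X,\mathcal N,\mathcal W)$ and $DO(X,\mathcal N,\mathcal W)$ are played like $BM$ and $MB$ respectively, except that on every move $n$ player $\beta$ also chooses $M_n\in\mathcal N$ with $M_n\subset U_n$, and $\alpha$ wins if $(V_n,M_n)\in\mathcal W$, otherwise $\beta$ wins. A game is $\kappa$-favorable if player $\kappa$ has a winning strategy, and $\kappa$-unfavorable otherwise. For $r\in\{o,p,f,k\}$, $X$ is: $\Gamma^{BM}_r$-nonmeager if $MB(X,\mathfrak V_r(X))$ is $\beta$-unfavorable; $\Gamma^{BM}_r$-Baire if $BM(X,\mathfrak V_r(X))$ is $\beta$-unfavorable; a $\Gamma^{BM}_r$-space if $BM(X,\mathfrak V_r(X)\cup\mathfrak V_{BM}^*(X))$ is $\alpha$-favorable. For $t\in\{o,p\}$, $q\in\{l,k\}$, $X$ is: $\Gamma^{OD}_{t,q}$-nonmeager if $DO(X,\mathcal N_t(X),\mathfrak W_q(X))$ is $\beta$-unfavorable; $\Gamma^{OD}_{t,q}$-Baire if $OD(X,\mathcal N_t(X),\mathfrak W_q(X))$ is $\beta$-unfavorable; a $\Gamma^{OD}_{t,q}$-space if $OD(X,\mathcal N_t(X),\mathfrak W_q(X)\cup\mathfrak W_e(X))$ is $\alpha$-favorable. *)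

(* Defs.v *)
From mathcomp Require Import all_boot all_order all_algebra.
From mathcomp Require Import all_classical all_reals all_analysis.

Set Implicit Arguments.
Unset Strict Implicit.
Unset Printing Implicit Defensive.

Local Open Scope classical_set_scope.

Section BaireCategory.
Variable X : topologicalType.

Definition nonempty_open : set (set X) := [set U | open U /\ U !=set0].

(* Nonempty countable families of sets are the ranges of sequences; the empty
   family is covered by the constant sequence setT. *)
Definition baire_space :=
  forall G : nat -> set X, (forall n, open (G n) /\ dense (G n)) ->
    dense (\bigcap_n G n).

Definition nonmeager_space :=
  forall G : nat -> set X, (forall n, open (G n) /\ dense (G n)) ->
    \bigcap_n G n !=set0.

End BaireCategory.
Arguments nonempty_open : clear implicits.
Arguments baire_space : clear implicits.
Arguments nonmeager_space : clear implicits.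

Inductive net_kind := net_o | net_p.
Inductive bm_kind := bm_o | bm_p | bm_f | bm_k.
Inductive od_kind := od_l | od_k.

Section Sequences.
Variable X : topologicalType.

Definition upper_limit (M : nat -> set X) : set X :=
  [set x | forall U, nbhs x U -> infinite_set [set n | U `&` M n !=set0]].

Definition nonprincipal_ultrafilter (p : set_system nat) :=
  UltraFilter p /\ forall n, p <> principal_filter n.

Definition seqV : set (nat -> set X) :=
  [set V | forall n, nonempty_open X (V n) /\ V n.+1 `<=` V n].

Definition seqV_BM : set (nat -> set X) :=
  [set V | seqV V /\ \bigcap_n V n !=set0].

Definition seqV_BMstar : set (nat -> set X) := seqV `\` seqV_BM.

Definition seqW : set (nat -> set X * set X) :=
  [set VM | forall n, [/\ nonempty_open X (VM n).1, (VM n).2 !=set0,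
     (VM n.+1).1 `<=` (VM n).1 & (VM n.+1).2 `<=` (VM n).1]].

Definition seqW_e : set (nat -> set X * set X) :=
  [set VM | seqW VM /\ \bigcap_n (VM n).1 = set0].

Definition seqW_l : set (nat -> set X * set X) :=
  [set VM | seqW VM /\
    upper_limit (fun n => (VM n).2) `&` \bigcap_n (VM n).1 !=set0].

Definition seqW_k : set (nat -> set X * set X) :=
  [set VM | seqW VM /\ exists xs : nat -> X, (forall n, (VM n).2 (xs n)) /\
    forall p : set_system nat, nonprincipal_ultrafilter p ->
      exists2 x, (\bigcap_n (VM n).1) x & xs @ p --> x].

Definition seqW_of (q : od_kind) : set (nat -> set X * set X) :=
  match q with od_l => seqW_l | od_k => seqW_k end.

Definition net (t : net_kind) : set (set X) :=
  match t with
  | net_o => nonempty_open X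
  | net_p => [set A | exists x, A = [set x]]
  end.

Definition seqV_net (t : net_kind) : set (nat -> set X) :=
  [set V | seqV V /\ forall M : nat -> set X,
    (forall n, net t (M n) /\ M n `<=` V n) ->
    seqW_l (fun n => (V n, M n))].

Definition seqV_f : set (nat -> set X) :=
  [set V | seqV_BM V /\ exists2 x, (\bigcap_n V n) x &
    forall U, nbhs x U -> exists n, V n `<=` U].

Definition seqV_k : set (nat -> set X) :=
  [set V | [/\ seqV_BM V, compact (\bigcap_n V n) &
    forall W, open W -> \bigcap_n V n `<=` W -> exists n, V n `<=` W]].

Definition seqV_of (r : bm_kind) : set (nat -> set X) :=
  match r with
  | bm_o => seqV_net net_o
  | bm_p => seqV_net net_p
  | bm_f => seqV_f
  | bm_k => seqV_k
  end.

End Sequences.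
Arguments seqV_of : clear implicits.
Arguments seqW_of : clear implicits.
Arguments seqV_BMstar : clear implicits.
Arguments seqW_e : clear implicits.
Arguments net : clear implicits.

(* On move n, alpha plays a set U n and then beta plays an answer b n, whose
   open component [part (b n)] constrains the next move of alpha:
   - [first] is the set of legal initial moves U 0 of alpha, while for n > 0 the
     legal moves are the nonempty open subsets of [part (b n.-1)];
   - [rule U] is the set of legal answers of beta to the move U;
   - alpha wins iff the sequence of answers of beta belongs to [payoff]. *)
Record game (X : topologicalType) := Game {
  answer : Type;
  part : answer -> set X;
  first : set (set X);
  rule : set X -> set answer;
  payoff : set (nat -> answer)
}.

Section Strategies.
Variables (X : topologicalType) (G : game X).

Definition alpha_legal (U : nat -> set X) (b : nat -> answer G) (n : nat) :=
  if n is m.+1 then nonempty_open X (U n) /\ U n `<=` part (b m)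
  else first G (U n).

Definition beta_legal (U : nat -> set X) (b : nat -> answer G) (n : nat) :=
  rule (U n) (b n).

Definition history (U : nat -> set X) (b : nat -> answer G) (n : nat) :=
  mkseq (fun i => (U i, b i)) n.

(* Legality is required at every finite stage, not just along infinite plays:
   a strategy leading to a position where its owner has no legal move is not
   winning (this matters when X is empty). *)
Definition alpha_winning (s : seq (set X * answer G) -> set X) :=
  forall (U : nat -> set X) (b : nat -> answer G),
    (forall n, (forall i, (i <= n)%N -> U i = s (history U b i)) ->
       (forall i, (i < n)%N -> beta_legal U b i) -> alpha_legal U b n) /\
    ((forall n, U n = s (history U b n)) -> (forall n, beta_legal U b n) ->
       payoff b).

Definition beta_winning (s : seq (set X * answer G) -> set X -> answer G) :=
  forall (U : nat -> set X) (b : nat -> answer G),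
    (forall n, (forall i, (i <= n)%N -> b i = s (history U b i) (U i)) ->
       (forall i, (i <= n)%N -> alpha_legal U b i) -> beta_legal U b n) /\
    ((forall n, b n = s (history U b n) (U n)) ->
       (forall n, alpha_legal U b n) -> ~ payoff b).

Definition alpha_favorable := exists s, alpha_winning s.
Definition beta_favorable := exists s, beta_winning s.
Definition beta_unfavorable := ~ beta_favorable.

End Strategies.

Section Games.
Variable X : topologicalType.

Definition bm_rule (U : set X) : set (set X) :=
  [set V | nonempty_open X V /\ V `<=` U].

Definition od_rule (N : set (set X)) (U : set X) : set (set X * set X) :=
  [set VM | [/\ nonempty_open X VM.1, VM.1 `<=` U, N VM.2 & VM.2 `<=` U]].

Definition BM (P : set (nat -> set X)) : game X :=
  @Game X (set X) id [set setT] bm_rule P.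

Definition MB (P : set (nat -> set X)) : game X :=
  @Game X (set X) id (nonempty_open X) bm_rule P.

Definition OD (N : set (set X)) (P : set (nat -> set X * set X)) : game X :=
  @Game X (set X * set X) fst [set setT] (od_rule N) P.

Definition DO (N : set (set X)) (P : set (nat -> set X * set X)) : game X :=
  @Game X (set X * set X) fst (nonempty_open X) (od_rule N) P.

End Games.

Inductive game_class :=
  | GammaBM of bm_kind
  | GammaOD of net_kind & od_kind.

Definition Gamma_nonmeager (g : game_class) (X : topologicalType) :=
  match g with
  | GammaBM r => beta_unfavorable (MB (seqV_of X r))
  | GammaOD t q => beta_unfavorable (DO (net X t) (seqW_of X q))
  end.

Definition Gamma_Baire (g : game_class) (X : topologicalType) :=
  match g with
  | GammaBM r => beta_unfavorable (BM (seqV_of X r))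
  | GammaOD t q => beta_unfavorable (OD (net X t) (seqW_of X q))
  end.

Definition Gamma_space (g : game_class) (X : topologicalType) :=
  match g with
  | GammaBM r => alpha_favorable (BM (seqV_of X r `|` seqV_BMstar X))
  | GammaOD t q => alpha_favorable (OD (net X t) (seqW_of X q `|` seqW_e X))
  end.

(* Main.v *)
Require Import Defs.
From mathcomp Require Import all_boot all_order all_algebra.
From mathcomp Require Import all_classical all_reals all_analysis.

(** The statement combines a winning strategy [s] of alpha, for a payoff that
    also accepts every sequence with empty intersection, with the Baire category
    hypothesis.

    Suppose that beta had a winning strategy [t] for the smaller payoff.  Couple
    the two strategies: when [s] proposes an open set [S n], let alpha play any
    nonempty open [U n] inside [S n], let beta answer [b n] according to [t], and
    report [b n] to [s] as an answer to [S n].  This is legal in both games,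
    because an answer to a smaller set is also an answer to a larger one.  The
    same sequence [b] of answers is then produced by a play won by [s] and by a
    play won by [t], so its open parts have empty intersection.  Since
    [S n.+1] lies inside the open part of [b n], the sets [S n] have empty
    intersection too, whatever the moves [U n] are ([coupling_contradiction]).

    On the other hand the positions of the coupled play form a tree: every
    position has an open set [S n], and below every nonempty open part of [S n]
    lies the open set of some successor.  The argument of Choquet and Oxtoby
    prunes this tree so that the sets of each level are pairwise disjoint and
    have dense union; a point in all these unions follows a single branch, and
    lies in all the sets of this branch ([exists_branch]).  Such a point exists
    by the category hypothesis.  When alpha chooses the first move freely the
    root is the empty position, with the whole space as its set, and it is enough
    that the space be nonmeager.  When the first move is the whole space, the
    root is the position after it, and density of the countable intersection is
    used inside the set [S 1]. *)

Set Implicit Arguments.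
Unset Strict Implicit.
Unset Printing Implicit Defensive.

Local Open Scope classical_set_scope.

(** * Branches of a tree of open sets *)

Section Branch.
Variables (X : topologicalType) (T : Type) (O : T -> set X).

(** Maximality alone gives density: a nonempty open set missing the whole family
    would contain a candidate that could be added to it. *)
Lemma ex_disjoint_dense_family (D : set T) (A : set X) :
  (forall W, nonempty_open X W -> W `<=` A ->
     exists t, [/\ D t, O t !=set0 & O t `<=` W]) ->
  exists C : set T, [/\ C `<=` D, trivIset C O &
    forall W, nonempty_open X W -> W `<=` A ->
      exists2 t, C t & W `&` O t !=set0].
Proof.
move=> refine.
have [C [CD disjC maxC]] := ex_maximal_disjoint_subcollection O D.
exists C; split=> // W Wo WA; apply: contrapT => noC.
have missW t : C t -> W `&` O t = set0.
  by move=> Ct; apply: contrapT => /eqP/set0P ne; apply: noC; exists t.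
have [t [Dt [x Otx] OtW]] := refine W Wo WA.
apply: (maxC (C `|` [set t])).
- split; first by move=> u; left.
  move=> /(_ t (or_intror erefl)) Ct; suff : set0 x by [].
  by rewrite -(missW t Ct); split=> //; apply: OtW.
- by move=> u [/CD//|->].
- move=> u v [Cu|->] [Cv|->] //; first exact: disjC.
  + by move=> [y [Ouy /OtW Wy]]; suff : set0 y by []; rewrite -(missW u Cu).
  + by move=> [y [/OtW Wy Ovy]]; suff : set0 y by []; rewrite -(missW v Cv).
Qed.

Variables (E : T -> T -> Prop) (K : set T).
Hypothesis refine : forall t W, K t -> nonempty_open X W -> W `<=` O t ->
  exists t', [/\ E t t', K t', nonempty_open X (O t') & O t' `<=` W].

(** Choosing below each node a maximal disjoint family of successors makes the
    sets of every level pairwise disjoint, so that a point lying in the union of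
    each level singles out one node per level, and disjointness forces each of
    these nodes to be a successor of the previous one.  The predicate [K] cuts
    out the part of the tree in which successors exist; the category hypothesis
    is localized to the set of the root so that it covers both the nonmeager and
    the Baire case. *)
Lemma exists_branch (r : T) : K r -> open (O r) ->
  (forall G : nat -> set X, (forall n, open (G n) /\ dense (G n)) ->
     O r `&` \bigcap_n G n !=set0) ->
  exists h : nat -> T, [/\ h 0 = r, forall n, E (h n) (h n.+1),
    forall n, K (h n) & \bigcap_n O (h n) !=set0].
Proof.
move=> Kr openr category.
pose child t := [set t' | [/\ E t t', K t', nonempty_open X (O t') &
  O t' `<=` O t]].
have /choice[C C_P] t : exists C : set T, K t ->
    [/\ C `<=` child t, trivIset C O &
      forall W, nonempty_open X W -> W `<=` O t ->
        exists2 t', C t' & W `&` O t' !=set0].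
  have [Kt|nKt] := pselect (K t); last by exists set0.
  have [|D DP] := @ex_disjoint_dense_family (child t) (O t); last by exists D.
  move=> W Wo Wt; have [t' [Ett' Kt' [Oo Ot'] Ot'W]] := refine Kt Wo Wt.
  exists t'; split=> //; split=> //; exact: subset_trans Wt.
pose level := fix level n : set T :=
  if n is m.+1 then \bigcup_(t in level m) C t else [set r].
have levelK n t : level n t -> K t /\ open (O t).
  elim: n t => [|n IHn] t /=; first by move->.
  by move=> [u /IHn[Ku _]]; have [sub _ _] := C_P u Ku => /sub[_ ? [? _] _].
have levelI n t u x : level n t -> level n u -> O t x -> O u x -> t = u.
  elim: n t u => [|n IHn] t u /=; first by move=> -> ->.
  move=> [t1 L1 Ct] [u1 L2 Cu] tx ux.
  have [K1 _] := levelK _ _ L1; have [sub1 disj _] := C_P _ K1.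
  have [K2 _] := levelK _ _ L2; have [sub2 _ _] := C_P _ K2.
  have [_ _ _ /(_ _ tx) t1x] := sub1 _ Ct.
  have [_ _ _ /(_ _ ux) u1x] := sub2 _ Cu.
  have eq_parent := IHn _ _ L1 L2 t1x u1x.
  rewrite -eq_parent in Cu.
  by apply: disj => //; exists x.
have level_dense n W : nonempty_open X W -> W `<=` O r ->
    exists2 t, level n t & W `&` O t !=set0.
  elim: n W => [|n IHn] W Wo Wr.
    exists r => //; have [_ [x Wx]] := Wo.
    by exists x; split=> //; apply: Wr.
  have [t Lt ne] := IHn W Wo Wr.
  have [Kt Ot] := levelK _ _ Lt; have [_ _ dense_t] := C_P t Kt.
  have [|y Wty|t' Ct' [x [[Wx _] t'x]]] := dense_t (W `&` O t).
  - by split=> //; apply: openI => //; case: Wo.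
  - by case: Wty.
  - by exists t'; [exists t | exists x].
(* Outside the set of the root nothing is asked of the levels, so the exterior
   of that set is added to make their unions dense in the whole space. *)
pose G n := (\bigcup_(t in level n) O t) `|` (~` O r)°.
have [|x [rx Gx]] := category G.
  move=> n; split.
    apply: openU; last exact: open_interior.
    by apply: bigcup_open => t /levelK[].
  move=> W Wne Wo; have [[y [Wy ry]]|Wr] := pselect (W `&` O r !=set0).
    have [||t Lt [x [[Wx _] tx]]] := level_dense n (W `&` O r).
    - by split; [exact: openI | exists y].
    - by move=> z [].
    - by exists x; split=> //; left; exists t.
  have [y Wy] := Wne; exists y; split=> //; right.
  suff : W `<=` (~` O r)° by apply.
  by rewrite -open_subsetE// => z Wz rz; apply: Wr; exists z.
have /choice[h hP] n : exists t, level n t /\ O t x.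
  have [[t Lt tx]|/interior_subset//] := Gx n I.
  by exists t.
exists h; split.
- by have [] := hP 0.
- move=> n; have [[t Lt Ct] hx] := hP n.+1.
  have [Kt _] := levelK _ _ Lt; have [/(_ _ Ct)[Et _ _ sub] _ _] := C_P t Kt.
  have [Ln nx] := hP n.
  by rewrite (levelI n _ _ x Ln Lt nx (sub _ hx)).
- by move=> n; have [/levelK[]] := hP n.
- by exists x => n _; have [] := hP n.
Qed.

End Branch.

(** * Coupling strategies of the two players *)

Section Coupling.
Variables (X : topologicalType) (A : Type) (part : A -> set X).
Variables (first : set (set X)) (rule : set X -> set A).
Variables P Q : set (nat -> A).

Let GA : game X := @Game X A part [set setT] rule (P `|` Q).
Let GB : game X := @Game X A part first rule P.

Variables (s : seq (set X * A) -> set X) (t : seq (set X * A) -> set X -> A).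

(** Both histories are built at once because the answers of beta, which come
    from the second one, also feed the strategy [s] in the first one. *)
Fixpoint coupled (U : nat -> set X) (n : nat) :
    seq (set X * A) * seq (set X * A) :=
  if n is m.+1 then
    let h := coupled U m in
    let a := t h.2 (U m) in
    (rcons h.1 (s h.1, a), rcons h.2 (U m, a))
  else ([::], [::]).

Definition reply U n := t (coupled U n).2 (U n).
Definition proposal U n := s (coupled U n).1.

Lemma coupledE U n : coupled U n =
  (@history X GA (proposal U) (reply U) n, @history X GB U (reply U) n).
Proof.
elim: n => [//|n IHn]; rewrite /history !mkseqS /=.
by rewrite /reply /proposal IHn.
Qed.

Lemma eq_coupled U U' n :
  (forall i, (i < n)%N -> U i = U' i) -> coupled U n = coupled U' n.
Proof.
elim: n => [//|n IHn] eqU /=.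
rewrite IHn ?eqU// => i lt_in; exact/eqU/ltnW.
Qed.

Lemma eq_proposal U U' n :
  (forall i, (i < n)%N -> U i = U' i) -> proposal U n = proposal U' n.
Proof. by move=> eqU; rewrite /proposal (eq_coupled eqU). Qed.

Lemma eq_reply U U' n :
  (forall i, (i < n.+1)%N -> U i = U' i) -> reply U n = reply U' n.
Proof.
move=> eqU; rewrite /reply eqU// (@eq_coupled U U')// => i lt_in.
exact/eqU/ltnW.
Qed.

Hypothesis s_wins : @alpha_winning X GA s.
Hypothesis t_wins : @beta_winning X GB t.
Hypothesis rule_open : forall U b, rule U b ->
  nonempty_open X (part b) /\ part b `<=` U.
Hypothesis rule_mono : forall U U' b, U `<=` U' -> rule U b -> rule U' b.

Definition coupled_legal U n :=
  @alpha_legal X GB U (reply U) n /\ U n `<=` proposal U n.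

Lemma eq_coupled_legal U U' n : (forall i, (i < n.+1)%N -> U i = U' i) ->
  coupled_legal U n -> coupled_legal U' n.
Proof.
move=> eqU; rewrite /coupled_legal (@eq_proposal U U') ?eqU//; last first.
  by move=> i lt_in; apply/eqU/ltnW.
case: n eqU => [|n] eqU /=; rewrite eqU// (@eq_reply U U')// => i lt_in.
exact/eqU/ltnW.
Qed.

Lemma reply_rule U n : (forall i, (i <= n)%N -> coupled_legal U i) ->
  rule (U n) (reply U n).
Proof.
move=> legal; apply: (t_wins U (reply U)).1 => [i _|i /legal[]//].
by rewrite /reply coupledE.
Qed.

Lemma proposal_legal U n : (forall i, (i < n)%N -> coupled_legal U i) ->
  @alpha_legal X GA (proposal U) (reply U) n.
Proof.
move=> legal; apply: (s_wins (proposal U) (reply U)).1 => [i _|i lt_in].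
  by rewrite /proposal coupledE.
rewrite /beta_legal; apply: (rule_mono (legal i lt_in).2).
by apply: reply_rule => j le_ji; apply/legal/(leq_ltn_trans le_ji).
Qed.

Lemma proposal_open U n : (forall i, (i < n)%N -> coupled_legal U i) ->
  open (proposal U n).
Proof.
move=> /proposal_legal; case: n => [/= ->|n /= [[]//]]; exact: openT.
Qed.

(** Both strategies win the same sequence of answers, which is only possible
    because the payoff of the first game was enlarged. *)
Lemma coupling_contradiction U :
  (forall b, Q b -> \bigcap_n part (b n) = set0) ->
  (forall n, coupled_legal U n) ->
  \bigcap_n proposal U n.+1 = set0.
Proof.
move=> Q0 legal; rewrite -subset0 => x Sx.
have [Pb|Qb] : (P `|` Q) (reply U).
- apply: (s_wins (proposal U) (reply U)).2 => n.
    by rewrite /proposal coupledE.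
  by apply: (rule_mono (legal n).2); apply: reply_rule.
- case: ((t_wins U (reply U)).2) => // n; first by rewrite /reply coupledE.
  by have [] := legal n.
- rewrite -(Q0 _ Qb) => n _.
  have /= [_] : @alpha_legal X GA (proposal U) (reply U) n.+1.
    by apply: proposal_legal => i _.
  by apply; apply: Sx.
Qed.

(** Both strategies are deterministic, so the list of the moves [U i] determines
    a coupled position.  The default value of [nth] is never read: only the moves
    with index below the length of the list influence what is used. *)
Let moves (u : seq (set X)) := nth setT u.
Let next_proposal (u : seq (set X)) := proposal (moves u) (size u).
Let position (r u : seq (set X)) :=
  (size r <= size u)%N /\ forall i, (i < size u)%N -> coupled_legal (moves u) i.

(** The tree of coupled positions, each carrying the next proposal of [s], has a
    branch with a point common to all proposals, which contradicts
    [coupling_contradiction].  The root [r] is the opening imposed on alpha: it is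
    empty when the first move is free, and otherwise consists of this single
    move. *)
Lemma no_coupling (r : seq (set X)) :
  (forall b, Q b -> \bigcap_n part (b n) = set0) ->
  (forall W, size r = 0 -> nonempty_open X W -> first W) ->
  (size r <= 1)%N ->
  (forall i, (i < size r)%N -> coupled_legal (moves r) i) ->
  (forall G : nat -> set X, (forall n, open (G n) /\ dense (G n)) ->
    proposal (moves r) (size r) `&` \bigcap_n G n !=set0) ->
  False.
Proof.
move=> Q0 first_open r1 legal_r category.
pose E u u' := exists W : set X, u' = rcons u W.
(* If alpha plays an arbitrary part [W] of the proposal, then the answer of
   beta, and hence the next proposal, is contained in [W]. *)
have refine u W : position r u -> nonempty_open X W ->
    W `<=` next_proposal u -> exists u', [/\ E u u', position r u',
      nonempty_open X (next_proposal u') & next_proposal u' `<=` W].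
  move=> [le_ru legal_u] Wo WS; exists (rcons u W).
  have eqU i : (i < size u)%N -> moves u i = moves (rcons u W) i.
    by move=> lt_iu; rewrite /moves nth_rcons lt_iu.
  have lastU : moves (rcons u W) (size u) = W.
    by rewrite /moves nth_rcons ltnn eqxx.
  have legal i : (i < (size u).+1)%N -> coupled_legal (moves (rcons u W)) i.
    rewrite ltnS leq_eqVlt => /orP[/eqP->|lt_iu]; last first.
      apply: eq_coupled_legal (legal_u i lt_iu) => j le_ji.
      exact/eqU/(leq_trans le_ji).
    split; last by rewrite lastU -(eq_proposal eqU).
    have := @proposal_legal (moves u) (size u) legal_u; move: lastU eqU WS.
    rewrite /next_proposal; case eq_n: (size u) => [|n] /= -> eqU WS.
      by move=> _; apply: first_open => //; apply/eqP; rewrite -leqn0 -eq_n.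
    rewrite -(@eq_reply (moves u)) => [[_ sub]|j]; last exact: eqU.
    by split=> //; apply: subset_trans WS sub.
  have := @proposal_legal _ (size u).+1 legal; rewrite /= => -[So Sb].
  rewrite /position /next_proposal size_rcons; split=> //.
  - by exists W.
  - by split=> //; apply: ltnW.
  - have := @reply_rule (moves (rcons u W)) (size u) legal.
    by rewrite lastU => /rule_open[_]; apply: subset_trans.
have [|h [h0 hE hK [x hx]]] :=
  exists_branch refine _ (proposal_open legal_r) category.
  by split.
have size_h n : size (h n) = (n + size r)%N.
  by elim: n => [|n IHn]; rewrite ?h0//; have [W ->] := hE n;
     rewrite size_rcons IHn.
have prefix_h m k i : (i < size (h m))%N ->
    moves (h (m + k)%N) i = moves (h m) i.
  move=> lt_im; elim: k => [|k IHk]; first by rewrite addn0.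
  rewrite addnS; have [W ->] := hE (m + k)%N.
  rewrite /moves nth_rcons; case: ifP => // /negP[].
  by apply: leq_trans lt_im _; rewrite !size_h -addnA leq_add2l leq_addl.
(* The node [h i.+1] has at least [i.+1] moves, so its move of index [i] is
   already final. *)
pose U i := moves (h i.+1) i.
have eqU n i : (i < size (h n))%N -> moves (h n) i = U i.
  move=> lt_in; have lt_ii : (i < size (h i.+1))%N.
    by rewrite size_h addSn ltnS leq_addr.
  have [le_ni|le_in] := leqP n i.+1.
    by rewrite /U -(subnKC le_ni) prefix_h.
  by rewrite -(subnKC (ltnW le_in)) prefix_h.
have legalU n : coupled_legal U n.
  have lt_n : (n < size (h n.+1))%N by rewrite size_h addSn ltnS leq_addr.
  apply: eq_coupled_legal ((hK n.+1).2 n lt_n) => i lt_in.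
  exact/eqU/(leq_trans lt_in).
suff : set0 x by [].
rewrite -(coupling_contradiction Q0 legalU) => n _.
have size_hn : size (h (n.+1 - size r)%N) = n.+1.
  by rewrite size_h subnK//; apply: leq_trans r1 _.
have := hx (n.+1 - size r)%N I; rewrite /next_proposal size_hn.
by rewrite (@eq_proposal _ U)// => i lt_in; apply: eqU; rewrite size_hn.
Qed.

End Coupling.

(** * From category to unfavorable games *)

Section Unfavorable.
Variables (X : topologicalType) (A : Type) (part : A -> set X).
Variables (rule : set X -> set A) (P Q : set (nat -> A)).
Hypothesis rule_open : forall U b, rule U b ->
  nonempty_open X (part b) /\ part b `<=` U.
Hypothesis rule_mono : forall U U' b, U `<=` U' -> rule U b -> rule U' b.
Hypothesis Q0 : forall b, Q b -> \bigcap_n part (b n) = set0.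
Hypothesis alpha_fav :
  alpha_favorable (@Game X A part [set setT] rule (P `|` Q)).

(** The coupled play starts from the empty position, where [s] proposes the whole
    space, so that a point of the countable intersection is enough. *)
Lemma nonmeager_beta_unfavorable : nonmeager_space X ->
  beta_unfavorable (@Game X A part (nonempty_open X) rule P).
Proof.
move=> nonmeager [t t_wins]; have [s s_wins] := alpha_fav.
apply: (no_coupling s_wins t_wins rule_open rule_mono (r := [::])) => // G GP.
have /= -> : proposal s t (nth setT [::]) 0 = setT.
  exact: (proposal_legal s_wins t_wins rule_mono (n := 0)).
by rewrite setTI; apply: nonmeager.
Qed.

(** The first move being imposed, the tree starts below it; its points all lie in
    the proposal [S 1], which is open and nonempty but otherwise depends on
    beta, whence the need for dense intersections. *)
Lemma Baire_beta_unfavorable : baire_space X ->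
  beta_unfavorable (@Game X A part [set setT] rule P).
Proof.
move=> baire [t t_wins]; have [s s_wins] := alpha_fav.
have legal i : (i < 1)%N ->
    coupled_legal part [set setT] rule P s t (nth setT [:: setT]) i.
  case: i => // _; split=> //=.
  by rewrite (_ : proposal _ _ _ _ = setT)//;
     apply: (proposal_legal s_wins t_wins rule_mono (n := 0)).
apply: (no_coupling s_wins t_wins rule_open rule_mono (r := [:: setT])) => //.
move=> G GP; have [[So Sne] _] :=
  proposal_legal s_wins t_wins rule_mono legal.
exact: baire GP _ Sne So.
Qed.

End Unfavorable.

Theorem proposition15 (X : topologicalType) (g : game_class) :
  (nonmeager_space X -> Gamma_space g X -> Gamma_nonmeager g X) /\
  (baire_space X -> Gamma_space g X -> Gamma_Baire g X).
Proof.
case: g => [r|t q] /=.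
- have rule_open (U b : set X) : bm_rule U b -> nonempty_open X b /\ b `<=` U.
    by [].
  have rule_mono (U U' b : set X) : U `<=` U' -> bm_rule U b -> bm_rule U' b.
    by move=> UU' [? bU]; split=> //; apply: subset_trans UU'.
  have empty b : seqV_BMstar X b -> \bigcap_n b n = set0.
    move=> [Vb nBM]; apply: contrapT => /eqP/set0P ne.
    by apply: nBM; split.
  split=> category fav.
  + exact: (nonmeager_beta_unfavorable rule_open rule_mono empty fav).
  + exact: (Baire_beta_unfavorable rule_open rule_mono empty fav).
- have rule_open (U : set X) b : od_rule (net X t) U b ->
      nonempty_open X b.1 /\ b.1 `<=` U by case.
  have rule_mono (U U' : set X) b : U `<=` U' ->
      od_rule (net X t) U b -> od_rule (net X t) U' b.
    by move=> UU' [? bU ? MU]; split=> //; apply: subset_trans UU'.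
  have empty b : seqW_e X b -> \bigcap_n (b n).1 = set0 by case.
  split=> category fav.
  + exact: (nonmeager_beta_unfavorable rule_open rule_mono empty fav).
  + exact: (Baire_beta_unfavorable rule_open rule_mono empty fav).
Qed.
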